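(* Let $n>1$. Let $Y$ be a space such that $\pi_n(Y)\cong\mathbb Z^2$ and some element $g\in\pi_1(Y)$ induces an automorphism of order $6$ on $\pi_n(Y)$ (via the canonical action of $\pi_1(Y)$ on $\pi_n(Y)$). Then, for any abelian group $V$, any finite-degree invariant $f\colon\pi_n(Y)\to V$ is constant.
   Context: $\mathbb N=\{0,1,2,\dots\}$. ''Space'' means pointed topological space; ''map'' means basepoint-preserving continuous map; homotopies are pointed, $[X,Y]$ is the set of pointed homotopy classes of maps $X\to Y$, and $\pi_n(Y)=[S^n,Y]$. For a space $X$, $C_0(X)$ denotes the group of unreduced zero-dimensional chains with integer coefficients, i.e. the free abelian group on all points of $X$. A map $a\colon X\to Y$ and a number $r\in\mathbb N$ give the Cartesian power $a^r\colon X^r\to Y^r$ and the induced homomorphism $C_0(a^r)\colon C_0(X^r)\to C_0(Y^r)$. For an abelian group $V$ and a function $f\colon[X,Y]\to V$ (called an invariant), the degree $\operatorname{Deg} f\in\mathbb N\cup\{\infty\}$ is defined by: $\operatorname{Deg} f\le r$ if and only if there is a homomorphism of abelian groups $l\colon\operatorname{Hom}(C_0(X^r),C_0(Y^r))\to V$ such that $f([a])=l(C_0(a^r))$ for all maps $a\colon X\to Y$. A finite-degree invariant is one with $\operatorname{Deg} f<\infty$. *)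

(* Defs.v *)
From HB Require Import structures.
From mathcomp Require Import all_boot all_order all_algebra generic_quotient.
From mathcomp Require Import all_classical reals topology normedtype.
From mathcomp Require Import lra.
From mathcomp.multinomials Require Import freeg.

Set Implicit Arguments.
Unset Strict Implicit.
Unset Printing Implicit Defensive.

Import Order.TTheory GRing.Theory Num.Theory.
Import numFieldNormedType.Exports.

Local Open Scope classical_set_scope.
Local Open Scope ring_scope.
Local Open Scope quotient_scope.

Section Gluing.

Lemma continuous_pairing (Z T U : topologicalType) (f : Z -> T) (g : Z -> U) :
  continuous f -> continuous g -> continuous (fun z => (f z, g z)).
Proof.
move=> cf cg z; have := @cvg_pair _ _ _ (nbhs z) (nbhs (f z)) (nbhs (g z)).
by move=> /(_ _ _ _ f g); apply; [exact: cf|exact: cg].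
Qed.

Lemma continuous_compose (Z T U : topologicalType) (f : T -> U) (g : Z -> T) :
  continuous g -> continuous f -> continuous (f \o g).
Proof. by move=> cg cf z; apply: continuous_comp; [exact: cg|exact: cf]. Qed.

Lemma continuous_fst (T U : topologicalType) : continuous (@fst T U).
Proof. by move=> z; exact: cvg_fst. Qed.

Lemma continuous_snd (T U : topologicalType) : continuous (@snd T U).
Proof. by move=> z; exact: cvg_snd. Qed.

Lemma continuous_comp_in (Z T U : topologicalType) (D : set T) (phi : Z -> T)
    (f : T -> U) :
  (forall z, D (phi z)) -> continuous phi -> {within D, continuous f} ->
  continuous (f \o phi).
Proof.
move=> Dphi cphi /subspace_sigL_continuousP cf.
pose psi (z : Z) : D := SigSub (mem_set (Dphi z)).
have cpsi : continuous psi by apply: continuous_comp_initial.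
have -> : f \o phi = sigL D f \o psi by [].
by move=> z; apply: continuous_comp; [exact: cpsi | exact: cf].
Qed.

Lemma continuous_paste (T U : topologicalType) (A B : set T) (b : T -> bool)
    (f g : T -> U) :
  closed A -> closed B ->
  (forall x, b x -> A x) -> (forall x, ~~ b x -> B x) ->
  (forall x, A x -> B x -> f x = g x) ->
  {within A, continuous f} -> {within B, continuous g} ->
  continuous (fun x => if b x then f x else g x).
Proof.
move=> cA cB bA bB fg cf cg; set h := fun x => _.
have hA : {in A, f =1 h}.
  move=> x /set_mem Ax; rewrite /h; case: ifPn => // /bB Bx.
  exact: fg.
have hB : {in B, g =1 h}.
  move=> x /set_mem Bx; rewrite /h; case: ifPn => // /bA Ax.
  by rewrite fg.
apply/continuous_subspace_setT.
have -> : [set: T] = A `|` B.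
  rewrite eqEsubset; split=> // x _.
  by case/boolP: (b x) => [/bA|/bB]; [left|right].
apply: withinU_continuous => //.
  exact: subspace_eq_continuous hA cf.
exact: subspace_eq_continuous hB cg.
Qed.

Lemma continuous_add (R : realType) (W : normedModType R) (Z : topologicalType)
    (f g : Z -> W) :
  continuous f -> continuous g -> continuous (fun z => f z + g z).
Proof. by move=> cf cg z; apply: cvgD; [exact: cf|exact: cg]. Qed.

Lemma continuous_sub (R : realType) (W : normedModType R) (Z : topologicalType)
    (f g : Z -> W) :
  continuous f -> continuous g -> continuous (fun z => f z - g z).
Proof. by move=> cf cg z; apply: cvgB; [exact: cf|exact: cg]. Qed.

Lemma continuous_scale (R : realType) (W : normedModType R)
    (Z : topologicalType) (s : Z -> R) (f : Z -> W) :
  continuous s -> continuous f -> continuous (fun z => s z *: f z).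
Proof. by move=> cs cf z; apply: cvgZ; [exact: cs|exact: cf]. Qed.

Lemma continuous_const (Z T : topologicalType) (c : T) :
  continuous (fun _ : Z => c).
Proof. by move=> z; exact: cvg_cst. Qed.

Lemma continuous_id (T : topologicalType) : continuous (fun x : T => x).
Proof. by move=> x; exact: cvg_id. Qed.

End Gluing.

Section PointedMaps.
Variables X Y : ptopologicalType.

Record pmap := PMap {
  pmap_fun :> X -> Y;
  pmap_continuous : continuous pmap_fun;
  pmap_point : pmap_fun point = point }.

HB.instance Definition _ := gen_eqMixin pmap.
HB.instance Definition _ := gen_choiceMixin pmap.

End PointedMaps.

Section Homotopy.
Variables (R : realType) (X Y : ptopologicalType).
Implicit Types a b c : pmap X Y.

Definition homotopic a b : Prop := exists H : X * R -> Y,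
  [/\ {within [set: X] `*` `[0, 1], continuous H},
      forall x, H (x, 0) = a x,
      forall x, H (x, 1) = b x &
      forall t, t \in `[0, 1] -> H (point, t) = point].

Definition clamp01 (t : R) : R := Num.max 0 (Num.min t 1).

Lemma clamp01_itv t : clamp01 t \in `[0, 1].
Proof.
by rewrite in_itv /= /clamp01 le_max lexx /= ge_max ler01 ge_min lexx orbT.
Qed.

Lemma clamp01_id t : t \in `[0, 1] -> clamp01 t = t.
Proof.
by rewrite in_itv /= => /andP[t0 t1]; rewrite /clamp01 min_l // max_r.
Qed.

Lemma clamp01_continuous : continuous clamp01.
Proof.
have c0 : continuous (cst 0 : R -> R^o) by move=> ?; exact: cvg_cst.
have c1 : continuous (cst 1 : R -> R^o) by move=> ?; exact: cvg_cst.
have cid : continuous (id : R -> R^o) by move=> ?; exact: cvg_id.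
move=> t; exact: (continuous_max (c0 t) (continuous_min (cid t) (c1 t))).
Qed.

(* A homotopy may be assumed to be continuous on the whole of [X * R]. *)
Lemma homotopicP a b : homotopic a b <-> exists H : X * R -> Y,
  [/\ continuous H, forall x, H (x, 0) = a x, forall x, H (x, 1) = b x &
      forall t, H (point, t) = point].
Proof.
split=> [[H [cH H0 H1 Hp]]|[H [cH H0 H1 Hp]]]; last first.
  by exists H; split=> //; exact: continuous_subspaceT.
exists (H \o (fun z => (z.1, clamp01 z.2))); split=> [|x|x|t] /=.
- have cphi : continuous (fun z : X * R => (z.1, clamp01 z.2)).
    apply: continuous_pairing; first exact: continuous_fst.
    exact: (continuous_compose (@continuous_snd _ _) clamp01_continuous).
  apply: (@continuous_comp_in _ _ _ _ _ H _ cphi cH) => z; split=> //=.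
  exact: clamp01_itv.
- by rewrite clamp01_id ?H0 // in_itv /= lexx ler01.
- by rewrite clamp01_id ?H1 // in_itv /= lexx ler01.
- exact/Hp/clamp01_itv.
Qed.

Lemma homotopic_refl a : homotopic a a.
Proof.
apply/homotopicP; exists (a \o fst); split=> //= [|t]; last exact: pmap_point.
exact: (continuous_compose (@continuous_fst _ _) (@pmap_continuous _ _ a)).
Qed.

Lemma homotopic_sym a b : homotopic a b -> homotopic b a.
Proof.
move=> /homotopicP[H [cH H0 H1 Hp]]; apply/homotopicP.
exists (H \o (fun z => (z.1, 1 - z.2))); split=> [|x|x|t] //=.
- apply: continuous_compose cH; apply: continuous_pairing.
    exact: continuous_fst.
  by move=> z; apply: cvgB; [exact: cvg_cst|exact: cvg_snd].
- by rewrite subr0.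
- by rewrite subrr.
Qed.

Lemma homotopic_trans b a c : homotopic a b -> homotopic b c -> homotopic a c.
Proof.
move=> /homotopicP[H [cH H0 H1 Hp]] /homotopicP[K [cK K0 K1 Kp]].
apply/homotopicP.
pose u (z : X * R) := (z.1, 2 * z.2); pose v (z : X * R) := (z.1, 2 * z.2 - 1).
exists (fun z => if z.2 <= 2^-1 then (H \o u) z else (K \o v) z).
have c2 : continuous (fun z : X * R => 2 * z.2).
  by move=> z; apply: cvgM; [exact: cvg_cst|exact: cvg_snd].
have csnd := @continuous_snd X R.
split=> [|x|x|t] /=.
- apply: (@continuous_paste (X * R)%type Y [set z | z.2 <= 2^-1]
    [set z | 2^-1 <= z.2] (fun z => z.2 <= 2^-1) (H \o u) (K \o v)).
  + exact: (closed_comp (fun z _ => csnd z) (@closed_le _ _)).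
  + exact: (closed_comp (fun z _ => csnd z) (@closed_ge _ _)).
  + by [].
  + by move=> z; rewrite -ltNge => /ltW.
  + move=> -[x t] /= t1 t2; have -> : t = 2^-1 by apply/eqP; rewrite eq_le t1.
    by rewrite /u /v /= divff ?pnatr_eq0 // subrr H1 K0.
  + apply/continuous_subspaceT/continuous_compose => //.
    exact/continuous_pairing/c2/continuous_fst.
  + apply/continuous_subspaceT/continuous_compose => //.
    apply/continuous_pairing; first exact: continuous_fst.
    by move=> z; apply: cvgB; [exact: c2|exact: cvg_cst].
- by rewrite /u invr_ge0 ler0n /= mulr0 H0.
- rewrite leNgt invf_lt1 ?ltr0n // ltr1n /= /v /= mulr1.
  by rewrite (_ : 2 - 1 = 1) ?K1 // -[2]/(1 + 1) addrK.
- by rewrite /u /v; case: ifP => _ /=; rewrite ?Hp ?Kp.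
Qed.

Definition homotopicb a b : bool := `[< homotopic a b >].

Lemma homotopicb_equiv : equiv_class_of homotopicb.
Proof.
split=> [a|a b|b a c].
- exact/asboolP/homotopic_refl.
- by apply/asboolP/asboolP; exact: homotopic_sym.
- by move=> /asboolP ab /asboolP bc; apply/asboolP; exact: homotopic_trans ab bc.
Qed.

Canonical homotopic_equiv := EquivRelPack homotopicb_equiv.
Canonical homotopic_encModRel := defaultEncModRel homotopicb.

(* [X, Y] *)
Definition htpy_set : Type := {eq_quot homotopicb}.

HB.instance Definition _ := Choice.on htpy_set.
HB.instance Definition _ := Quotient.on htpy_set.
HB.instance Definition _ : EqQuotient _ homotopicb htpy_set :=
  EqQuotient.on htpy_set.

Definition htpy_class a : htpy_set := \pi a.

Lemma htpy_classP a b : htpy_class a = htpy_class b <-> homotopic a b.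
Proof.
rewrite /htpy_class; split=> [/eqP|ab].
  by rewrite eqmodE => /asboolP.
by apply/eqP; rewrite eqmodE; exact/asboolP.
Qed.

End Homotopy.

Section Sphere.
Variables (R : realType) (n : nat).
Implicit Types x y : 'rV[R]_n.

Definition in_cube : set 'rV[R]_n := [set x | forall i, 0 <= x ord0 i <= 1].

Definition cube : Type := in_cube.

HB.instance Definition _ := Topological.on cube.
HB.instance Definition _ := SubType.on cube.

Lemma in_cube0 : (0 : 'rV[R]_n) \in in_cube.
Proof. by apply/mem_set => i; rewrite mxE lexx ler01. Qed.

HB.instance Definition _ := isPointed.Build cube (SigSub in_cube0).

Definition boundary (x : cube) : Prop :=
  exists i, \val x ord0 i = 0 \/ \val x ord0 i = 1.

Definition collapse (x y : cube) : bool :=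
  `[< x = y \/ boundary x /\ boundary y >].

Lemma collapse_equiv : equiv_class_of collapse.
Proof.
split=> [x|x y|y x z].
- by apply/asboolP; left.
- by apply/asboolP/asboolP => -[->|[]]; [left|right|left|right].
- move=> /asboolP[->|[bx by_]] /asboolP[<-|[bx' bz]]; apply/asboolP.
  + by left.
  + by right.
  + by right.
  + by right.
Qed.

Canonical collapse_equivRel := EquivRelPack collapse_equiv.
Canonical collapse_encModRel := defaultEncModRel collapse.

(* The sphere as I^n / bd I^n, with the class of the boundary as basepoint
   (for 0 < n). *)
Definition sphere : Type := quotient_topology {eq_quot collapse}.

HB.instance Definition _ := PointedTopological.on sphere.
HB.instance Definition _ := Quotient.on sphere.

Definition sphere_pi (x : cube) : sphere := \pi x.

Lemma sphere_piP (x y : cube) :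
  sphere_pi x = sphere_pi y <-> x = y \/ boundary x /\ boundary y.
Proof.
rewrite /sphere_pi; split=> [|xy].
  by move=> /(eqquotP {eq_quot collapse})/asboolP.
by apply/(eqquotP {eq_quot collapse})/asboolP.
Qed.

Definition outer : set 'rV[R]_n :=
  [set x | exists i, x ord0 i <= 0 \/ 1 <= x ord0 i].

Lemma boundaryE (x : cube) : boundary x <-> outer (\val x).
Proof.
have xc : in_cube (\val x) by exact/set_mem/(valP x).
split=> -[i xi]; exists i; have /andP[x0 x1] := xc i.
  by case: xi => ->; [left|right].
by case: xi => xi; [left|right]; apply/eqP; rewrite eq_le ?x0 ?x1 ?andbT.
Qed.

Lemma closed_coord (i : 'I_n) (A : set R) :
  closed A -> closed [set x : 'rV[R]_n | A (x ord0 i)].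
Proof. by apply: closed_comp => x _; exact: coord_continuous. Qed.

Lemma in_cube_closed : closed in_cube.
Proof.
have -> : in_cube = \bigcap_(i in [set: 'I_n]) [set x | 0 <= x ord0 i <= 1].
  by rewrite eqEsubset; split=> x /= xc i; [move=> _|]; exact: xc.
apply: closed_bigI => i _; apply: (closed_coord (A := [set t | 0 <= t <= 1])).
have -> : [set t : R | 0 <= t <= 1] = [set` `[0, 1]%R].
  by rewrite eqEsubset; split=> t /=; rewrite in_itv.
exact: interval_closed.
Qed.

Lemma outer_closed : closed outer.
Proof.
have -> : outer = \bigcup_(i in [set: 'I_n])
    [set x | [set t | t <= 0] (x ord0 i) \/ [set t | 1 <= t] (x ord0 i)].
  by rewrite eqEsubset; split=> [x [i xi]|x [i _ xi]]; exists i.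
apply: closed_bigcup => [|i _]; first exact: finite_finset.
by apply: closedU; apply: closed_coord; [exact: closed_le|exact: closed_ge].
Qed.

Lemma outer0 (i : 'I_n) : outer 0.
Proof. by exists i; left; rewrite mxE. Qed.

End Sphere.

Section SphereMaps.
Variables (R : realType) (n : nat) (Y : ptopologicalType).
Implicit Types a : pmap (sphere R n) Y.

(* Pointed maps out of the sphere are the same as maps on R^n which send
   everything outside the open unit cube to the basepoint. *)
Definition unroll a (x : 'rV[R]_n) : Y :=
  a (sphere_pi (insubd (point : cube R n) x)).

Lemma unrollE a (x : cube R n) : unroll a (\val x) = a (sphere_pi x).
Proof.
by congr (a (sphere_pi _)); apply: val_inj; rewrite insubdK //; exact: valP.
Qed.

Lemma unroll_outer a x : outer x -> unroll a x = point.
Proof.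
move=> ox; rewrite /unroll -[RHS](pmap_point a); congr (a _).
apply/sphere_piP; case: (boolP (x \in @in_cube R n)) => xc; last first.
  by left; rewrite /insubd insubN.
right; split; first by apply/boundaryE; rewrite insubdK.
by case: ox => i _; exists i; left; rewrite mxE.
Qed.

Lemma unroll_continuous a : continuous (unroll a).
Proof.
have cpi : continuous (a \o @sphere_pi R n : cube R n -> Y).
  apply: continuous_compose; last exact: pmap_continuous.
  exact: pi_continuous.
have cin : {within @in_cube R n, continuous (unroll a)}.
  apply/subspace_sigL_continuousP.
  rewrite (_ : sigL _ _ = a \o @sphere_pi R n) //.
  by apply/funext => x; exact: (unrollE a x).
apply/continuous_subspace_setT.
have -> : [set: 'rV[R]_n] = @in_cube R n `|` @outer R n.
  rewrite eqEsubset; split=> // x _; have [xo|xo] := pselect (outer x).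
    by right.
  left=> i; apply/andP; split; rewrite leNgt; apply/negP => /ltW xi; apply: xo.
    by exists i; left.
  by exists i; right.
apply: withinU_continuous => //; [exact: in_cube_closed|exact: outer_closed|].
apply: (@subspace_eq_continuous _ _ _ (cst point)) => [x /set_mem xo|].
  by have /esym := unroll_outer a xo.
exact/continuous_subspaceT/cts_fun.
Qed.

Section Roll.
Variable F : 'rV[R]_n -> Y.
Hypothesis F_continuous : continuous F.
Hypothesis F_outer : forall x, outer x -> F x = point.

Definition roll_fun (s : sphere R n) : Y := F (\val (repr s)).

Lemma roll_fun_pi (x : cube R n) : roll_fun (sphere_pi x) = F (\val x).
Proof.
have : sphere_pi x = sphere_pi (repr (sphere_pi x)) by rewrite /sphere_pi reprK.
move=> /sphere_piP; rewrite /roll_fun => -[<- //|[bx bx']].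
by rewrite !F_outer //; exact/boundaryE.
Qed.

Lemma roll_fun_continuous : continuous roll_fun.
Proof.
apply/quotient_continuous.
have -> : roll_fun \o \pi = F \o (\val : cube R n -> 'rV[R]_n).
  by apply/funext => x; exact: roll_fun_pi.
by apply: continuous_compose F_continuous; exact: initial_continuous.
Qed.

Hypothesis F_0 : F 0 = point.

Lemma roll_fun_point : roll_fun point = point.
Proof. by rewrite -F_0 -[RHS](roll_fun_pi point). Qed.

Definition roll : pmap (sphere R n) Y := PMap roll_fun_continuous roll_fun_point.

End Roll.

End SphereMaps.

Section HomotopyGroups.
Variables (R : realType) (Y : ptopologicalType).

Definition htpy_group (n : nat) : Type := htpy_set R (sphere R n) Y.

Section Operations.
Variable n : nat.
Implicit Types (x : 'rV[R]_n) (a b : pmap (sphere R n) Y).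

Section Concat.
Variables (i : 'I_n) (a b : pmap (sphere R n) Y).

(* Only the i-th coordinate t of x changes: it becomes 2t, resp. 2t - 1. *)
Definition concat_fun x : Y :=
  if x ord0 i <= 2^-1 then unroll a (x + x ord0 i *: delta_mx ord0 i)
  else unroll b (x + (x ord0 i - 1) *: delta_mx ord0 i).

Lemma stretchE x c j :
  (x + c *: delta_mx ord0 i) ord0 j = x ord0 j + (if j == i then c else 0).
Proof.
by rewrite !mxE eqxx /=; case: eqP => _; rewrite ?mulr1 ?mulr0.
Qed.

Lemma concat_fun_continuous : continuous concat_fun.
Proof.
have ci := @coord_continuous R 1 n ord0 i.
apply: (@continuous_paste 'rV[R]_n Y [set x | [set t | t <= 2^-1] (x ord0 i)]
  [set x | [set t | 2^-1 <= t] (x ord0 i)] (fun x => x ord0 i <= 2^-1)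
  (unroll a \o (fun x => x + x ord0 i *: delta_mx ord0 i))
  (unroll b \o (fun x => x + (x ord0 i - 1) *: delta_mx ord0 i))).
- by apply: closed_coord; exact: closed_le.
- by apply: closed_coord; exact: closed_ge.
- by [].
- by move=> x /=; rewrite -ltNge => /ltW.
- move=> x /= t1 t2; have xi : x ord0 i = 2^-1 by apply/eqP; rewrite eq_le t1.
  by rewrite !unroll_outer //; exists i; rewrite stretchE eqxx xi; [left|right];
    lra.
- apply/continuous_subspaceT/continuous_compose; last exact: unroll_continuous.
  apply: (@continuous_add R 'rV[R]_n); first exact: continuous_id.
  by apply: (@continuous_scale R 'rV[R]_n); [exact: ci|exact: continuous_const].
- apply/continuous_subspaceT/continuous_compose; last exact: unroll_continuous.
  apply: (@continuous_add R 'rV[R]_n); first exact: continuous_id.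
  apply: (@continuous_scale R 'rV[R]_n); last exact: continuous_const.
  by apply: (@continuous_sub R R); [exact: ci|exact: continuous_const].
Qed.

Lemma concat_fun_outer x : outer x -> concat_fun x = point.
Proof.
move=> [j xj]; rewrite /concat_fun; case: ifPn => xi; apply: unroll_outer;
  exists j; rewrite stretchE; case: eqP xj => [->|_]; rewrite ?addr0 //.
- by case=> ?; [left|right]; lra.
- by rewrite -ltNge in xi; case=> ?; [left|right]; lra.
Qed.

Definition concat : pmap (sphere R n) Y :=
  roll concat_fun_continuous concat_fun_outer (concat_fun_outer (outer0 R i)).

End Concat.

Section Action.
Variables (g : pmap (sphere R 1) Y) (a : pmap (sphere R n) Y).

(* The distance to the centre of the cube, with value 1 on its boundary; the
   norm on row vectors is the maximum norm. *)
Definition radius x : R := `|2 *: x - const_mx 1|.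

(* The map a is shrunk to the concentric cube of half the size, and the loop g
   is inserted on each radial segment from the boundary of the cube inwards. *)
Definition act_fun x : Y :=
  if radius x <= 2^-1 then unroll a (2 *: x - const_mx 2^-1)
  else unroll g (const_mx (2 - 2 * radius x)).

Lemma double_continuous (c : 'rV[R]_n) : continuous (fun x => 2 *: x - c).
Proof.
apply: (@continuous_sub R 'rV[R]_n); last exact: continuous_const.
apply: (@continuous_scale R 'rV[R]_n); first exact: continuous_const.
exact: continuous_id.
Qed.

Lemma radius_continuous : continuous radius.
Proof.
exact: (continuous_compose (@double_continuous _) (@norm_continuous R 'rV[R]_n)).
Qed.

Lemma radius_ge x i : `|2 * x ord0 i - 1| <= radius x.
Proof.
rewrite /radius [leRHS]/Num.norm /= mx_normrE.
by apply: le_trans (le_bigmax _ _ (ord0, i)); rewrite !mxE.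
Qed.

Lemma radius_attained x : radius x != 0 -> exists i,
  radius x = `|2 * x ord0 i - 1|.
Proof.
by move=> /mx_norm_neq0[[j i]] /= ri; exists i; rewrite /radius [LHS]ri !mxE ord1.
Qed.

Lemma act_fun_continuous : continuous act_fun.
Proof.
apply: (@continuous_paste 'rV[R]_n Y [set x | radius x <= 2^-1]
  [set x | 2^-1 <= radius x] (fun x => radius x <= 2^-1)
  (unroll a \o (fun x => 2 *: x - const_mx 2^-1))
  (unroll g \o (fun x => const_mx (2 - 2 * radius x)))).
- rewrite -[X in closed X]/(radius @^-1` [set t | t <= 2^-1]).
  by apply: closed_comp => [x _|]; [exact: radius_continuous|exact: closed_le].
- rewrite -[X in closed X]/(radius @^-1` [set t | 2^-1 <= t]).
  by apply: closed_comp => [x _|]; [exact: radius_continuous|exact: closed_ge].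
- by [].
- by move=> x; rewrite -ltNge => /ltW.
- move=> x /= r1 r2; have rx : radius x = 2^-1 by apply/eqP; rewrite eq_le r1.
  rewrite !unroll_outer //.
    by exists ord0; right; rewrite mxE rx; lra.
  have [|i] := @radius_attained x; first by rewrite rx; lra.
  rewrite rx => /esym ri; exists i; rewrite !mxE.
  by case: (ler0P (2 * x ord0 i - 1)) ri => ? ?; [left|right]; lra.
- apply/continuous_subspaceT/continuous_compose; last exact: unroll_continuous.
  exact: double_continuous.
- apply/continuous_subspaceT/continuous_compose; last exact: unroll_continuous.
  have -> : (fun x => const_mx (2 - 2 * radius x) : 'rV[R]_1) =
            (fun x => (2 - 2 * radius x) *: const_mx 1).
    by apply/funext => x; apply/rowP => j; rewrite !mxE mulr1.
  apply: (@continuous_scale R 'rV[R]_1); last exact: continuous_const.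
  apply: (@continuous_sub R R); first exact: continuous_const.
  apply: (@continuous_scale R R); first exact: continuous_const.
  exact: radius_continuous.
Qed.

Lemma act_fun_outer x : outer x -> act_fun x = point.
Proof.
move=> [i xi]; have r1 : 1 <= radius x.
  apply: le_trans (radius_ge x i).
  by case: xi => ?; [rewrite ler0_norm|rewrite ger0_norm]; lra.
rewrite /act_fun ifF; last by apply/negbTE; rewrite -ltNge; lra.
by apply: unroll_outer; exists ord0; left; rewrite mxE; lra.
Qed.

Lemma act_fun0 : act_fun 0 = point.
Proof.
have [n0|n_gt0] := posnP n; last exact/act_fun_outer/(outer0 R (Ordinal n_gt0)).
have E (x y : 'rV[R]_n) : x = y 
  by apply/rowP => -[j jn]; exfalso; move: jn; rewrite n0.
rewrite /act_fun /radius (E (2 *: 0 - _) 0) normr0 invr_ge0 ler0n.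
rewrite (E (2 *: 0 - _) (\val (point : cube R n))).
by rewrite unrollE pmap_point.
Qed.

Definition loop_act : pmap (sphere R n) Y :=
  roll act_fun_continuous act_fun_outer act_fun0.

End Action.

(* The sum is taken along the first coordinate of the cube. *)
Definition htpy_add (n_gt0 : (0 < n)%N) (x y : htpy_group n) : htpy_group n :=
  htpy_class R (concat (Ordinal n_gt0) (repr x) (repr y)).

Definition htpy_act (g : htpy_group 1) (x : htpy_group n) : htpy_group n :=
  htpy_class R (loop_act (repr g) (repr x)).

End Operations.
End HomotopyGroups.

(* Order of a bijection under composition. The map htpy_act g always is a group
   automorphism, so its order as an automorphism is the order defined here. *)
Definition has_order (T : Type) (t : T -> T) (k : nat) : Prop :=
  [/\ (0 < k)%N, forall x, iter k t x = x &
      forall j, (0 < j < k)%N -> exists x, iter j t x <> x].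

Section Hom.
Variables U V : zmodType.

Definition Hom : Type := {additive U -> V}.

HB.instance Definition _ := gen_eqMixin Hom.
HB.instance Definition _ := gen_choiceMixin Hom.

Lemma HomP (u v : Hom) : (u : U -> V) =1 v -> u = v.
Proof.
case: u v => [u [[uM]]] [v [[vM]]] /= /funext uv; subst v.
by rewrite (Prop_irrelevance uM vM).
Qed.

Definition Hom_zero : Hom := \0 : {additive U -> V}.
Definition Hom_opp (u : Hom) : Hom := \- u : {additive U -> V}.
Definition Hom_add (u v : Hom) : Hom := u \+ v : {additive U -> V}.

Lemma Hom_addA : associative Hom_add.
Proof. by move=> u v w; apply: HomP => x; exact: addrA. Qed.

Lemma Hom_addC : commutative Hom_add.
Proof. by move=> u v; apply: HomP => x; exact: addrC. Qed.

Lemma Hom_add0 : left_id Hom_zero Hom_add.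
Proof. by move=> u; apply: HomP => x; exact: add0r. Qed.

Lemma Hom_addN : left_inverse Hom_zero Hom_opp Hom_add.
Proof. by move=> u; apply: HomP => x; exact: addNr. Qed.

HB.instance Definition _ :=
  GRing.isZmodule.Build Hom Hom_addA Hom_addC Hom_add0 Hom_addN.

End Hom.

Section Chains.

Definition chain0 (S : choiceType) : zmodType := {freeg S}.

Variables (S T : choiceType) (u : S -> T).

Definition chain0_fun (c : chain0 S) : chain0 T :=
  fglift (fun s => << u s >> : {freeg T}) c.

Lemma chain0_fun_is_zmod_morphism : zmod_morphism chain0_fun.
Proof. exact: lift_is_additive. Qed.

HB.instance Definition _ := GRing.isZmodMorphism.Build (chain0 S) (chain0 T)
  chain0_fun chain0_fun_is_zmod_morphism.

Definition chain0_map : Hom (chain0 S) (chain0 T) :=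
  chain0_fun : {additive chain0 S -> chain0 T}.

End Chains.

Section Degree.
Variables (R : realType) (X Y : ptopologicalType) (V : zmodType).

(* Points of X^r are tuples; zero-dimensional chains do not see the topology. *)
Definition pow_map r (a : pmap X Y) : r.-tuple X -> r.-tuple Y :=
  fun x => map_tuple a x.

(* Deg f <= r *)
Definition deg_le (f : htpy_set R X Y -> V) (r : nat) : Prop :=
  exists l : {additive Hom (chain0 (r.-tuple X)) (chain0 (r.-tuple Y)) -> V},
    forall a : pmap X Y,
      f (htpy_class R a) = l (chain0_map (pow_map (r := r) a)).

Definition finite_degree (f : htpy_set R X Y -> V) : Prop :=
  exists r, deg_le f r.

End Degree.

(* Main.v *)
(** A finite-degree invariant [f] of degree at most [r] cannot see the alternating
    sum of a family of maps indexed by [m > r] switches if the value at each point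
    depends on at most one switch. Switching the summands of an iterated
    concatenation on and off makes [f] a polynomial function on [pi_n(Y)]; switching
    on and off loops [g] inserted in nested shells around one summand [y] gives
    [(g - 1)^m] applied to [y |-> f (z + y)] equal to [0]. An automorphism [g] of
    order 6 of [Z^2] satisfies [(1 - g) g = 1]. By induction on the degree it is
    enough to treat [f = c + l] with [l] additive; there [l ((g - 1)^m y) = 0], and
    [g - 1] is onto, so [l = 0]. *)

From HB Require Import structures.
Require Import Defs.
From mathcomp Require Import all_boot all_order all_algebra generic_quotient.
From mathcomp Require Import all_classical reals topology normedtype.
From mathcomp Require Import function_spaces lra ring zify.
From mathcomp.multinomials Require Import freeg.

Import Defs.

Set Implicit Arguments.
Unset Strict Implicit.
Unset Printing Implicit Defensive.

Import Order.TTheory GRing.Theory Num.Theory.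
Import numFieldNormedType.Exports.

Local Open Scope classical_set_scope.
Local Open Scope ring_scope.
Local Open Scope quotient_scope.

(** * Polynomial functions and twisting *)

Section Alternating.
Variable V : zmodType.
Implicit Types (F : seq bool -> V) (e : seq bool).

(** A list [e] records which switches are on; its term carries the sign -1 to the number of [false]
    entries. *)
Fixpoint alternating m F : V :=
  if m is m'.+1 then
    alternating m' (fun e => F (true :: e)) -
    alternating m' (fun e => F (false :: e))
  else F [::].

Lemma eq_alternating m F F' : F =1 F' -> alternating m F = alternating m F'.
Proof. by move=> /funext ->. Qed.

Lemma alternatingB m F F' :
  alternating m (fun e => F e - F' e) = alternating m F - alternating m F'.
Proof.
by elim: m F F' => //= m IH F F'; rewrite !IH opprD addrACA -opprD.
Qed.

(** The terms cancel in pairs that differ only in switch [i]. *)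
Lemma alternating_independent m i F : (i < m)%N ->
  (forall e e', (forall j, j != i -> nth false e j = nth false e' j) ->
    F e = F e') ->
  alternating m F = 0.
Proof.
elim: m i F => //= m IH [|i] F im Fi.
  apply/eqP; rewrite subr_eq0; apply/eqP/eq_alternating => e.
  by apply: Fi => -[].
rewrite !(IH i) ?subrr // => e e' ee'; apply: Fi => -[|j] //=;
  by rewrite eqSS => /ee'.
Qed.

End Alternating.

Lemma alternating_raddf (U V : zmodType) (l : {additive U -> V}) m F :
  l (alternating m F) = alternating m (fun e => l (F e)).
Proof. by elim: m F => //= m IH F; rewrite raddfB !IH. Qed.

Section Polynomial.
Variables (L V : zmodType) (g : L -> L).
Hypothesis gD : {morph g : x y / x + y}.
(** That is, [(1 - g) g = 1], so [g - 1] is onto; [X^2 - X + 1] is the sixth cyclotomic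
    polynomial. *)
Hypothesis g_sub : forall x, g x - g (g x) = x.
Implicit Types (h : L -> V).

Definition shift h z : L -> V := fun y => h (z + y).
Definition difference x h : L -> V := fun y => h (x + y) - h y.
Definition twist h : L -> V := fun y => h (g y) - h y.

(** Polynomial functions in the sense of Eilenberg and Mac Lane. *)
Fixpoint degree_lt m h : Prop :=
  if m is m'.+1 then forall x, degree_lt m' (difference x h)
  else forall y, h y = 0.

(** All shifts are included so that the property passes to differences: [twist] does not commute
    with translation. *)
Definition twist_nilpotent m h := forall z y, iter m twist (shift h z) y = 0.

Lemma iter_twistB m h h' y :
  iter m twist (fun y => h y - h' y) y = iter m twist h y - iter m twist h' y.
Proof.
by elim: m y => //= m IH y; rewrite /twist !IH opprD addrACA -opprD.
Qed.

Lemma twist_nilpotent_difference m x h :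
  twist_nilpotent m h -> twist_nilpotent m (difference x h).
Proof.
move=> hm z y.
rewrite -[LHS]/(iter m twist (fun y => h (x + (z + y)) - h (z + y)) y).
rewrite iter_twistB -[X in _ - X]/(iter m twist (shift h z) y) hm subr0.
rewrite -[RHS](hm (x + z) y); congr (iter m _ _ y).
by apply/funext => t; rewrite /shift addrA.
Qed.

(** For additive [h], [twist h] is [h] composed with [g - 1]. As [g - 1] is onto, each [twist] can
    be cancelled. *)
Lemma twist_nilpotent_additive m h :
  (forall x y, h (x + y) = h x + h y) -> (forall y, iter m twist h y = 0) ->
  forall y, h y = 0.
Proof.
elim: m h => //= m IH h hD hm.
have h0 : h 0 = 0 by apply: (addrI (h 0)); rewrite -hD !addr0.
have tD x y : twist h (x + y) = twist h x + twist h y.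
  by rewrite /twist gD !hD opprD addrACA.
have t0 : forall y, twist h y = 0.
  by apply: IH tD _ => y; rewrite -iterSr; exact: hm.
move=> y; rewrite -[y]g_sub hD -[RHS](subrr (h (g y))); congr (_ + _).
have /eqP := t0 (g y); rewrite subr_eq0 => /eqP <-.
by apply: (addrI (h (g (g y)))); rewrite -hD !subrr.
Qed.

(** Here [h] is a constant plus an additive map. The first of the [m] twists removes the constant,
    and the additive case gives [twist h = 0]. *)
Lemma twist_nilpotent_affine m h : (0 < m)%N -> twist_nilpotent m h ->
  (forall x y, difference x h y = difference x h 0) -> forall x y, h x = h y.
Proof.
case: m => // m _ hm haff.
have hE x y : h (x + y) = h x + h y - h 0.
  by have := haff x y; rewrite /difference addr0 => /(canRL (subrK _)) ->;
     rewrite addrAC.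
have tD x y : twist h (x + y) = twist h x + twist h y.
  by rewrite /twist gD !hE opprB addrA subrK opprD addrACA.
have t0 y : twist h y = 0.
  apply: (@twist_nilpotent_additive m) y => // y; rewrite -iterSr.
  rewrite -[RHS](hm 0 y); congr (iter _ _ _ y).
  by apply/funext => z; rewrite /shift add0r.
suff h0 x : h x = h 0 by move=> x y; rewrite h0 [RHS]h0.
(* Expand [h] at [x + g (g x) = g x]; its values at [g x] and [g (g x)] agree because
   [twist h = 0]. *)
have := hE (x) (g (g x)); rewrite -{1}(g_sub x) subrK.
have /eqP := t0 (g x); rewrite subr_eq0 => /eqP ->.
rewrite -addrA addrCA => /eqP; rewrite -{1}[h (g x)]addr0 (inj_eq (addrI _)).
by rewrite eq_sym subr_eq0 => /eqP.
Qed.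

(** Induction on the degree: each difference of [h] is constant, hence [h] is affine. *)
Lemma twist_nilpotent_constant m k h : (0 < m)%N -> twist_nilpotent m h ->
  degree_lt k h -> forall x y, h x = h y.
Proof.
move=> m_gt0; elim: k h => [|k IH] h hm hk; first by move=> x y; rewrite !hk.
apply: (twist_nilpotent_affine m_gt0 hm) => x y.
exact: IH (twist_nilpotent_difference x hm) (hk x) _ _.
Qed.

End Polynomial.

(** * Automorphisms of order 6 *)

Lemma additive_int2E (g : int * int -> int * int) x :
  {morph g : x y / x + y} ->
  g x = ((g (1, 0)).1 * x.1 + (g (0, 1)).1 * x.2,
         (g (1, 0)).2 * x.1 + (g (0, 1)).2 * x.2).
Proof.
move=> gD.
have gMz y c : g (y *~ c) = g y *~ c.
  have gB u v : g (u - v) = g u - g v.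
    by apply: (addIr (g v)); rewrite -gD !subrK.
  have gadd := GRing.isZmodMorphism.Build _ _ g gB.
  pose ga : {additive _ -> _} := HB.pack g gadd.
  exact: (raddfMz ga).
have E (y : int * int) c : y *~ c = (y.1 * c, y.2 * c).
  have fst_mulrz : (y *~ c).1 = y.1 *~ c by rewrite raddfMz.
  have snd_mulrz : (y *~ c).2 = y.2 *~ c by rewrite raddfMz.
  by rewrite [LHS]surjective_pairing fst_mulrz snd_mulrz !mulrzz.
case: x => a b.
have {1}-> : (a, b) = (1, 0) *~ a + (0, 1) *~ b :> (int * int)%type.
  by rewrite !E; congr (_, _); rewrite /= !(mul1r, mul0r, addr0, add0r).
by rewrite gD !gMz !E.
Qed.

(* By Cayley-Hamilton [g ^ 2 = t g - d]; iterating six times leaves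
   [t (t^2 - d) (t^2 - 3 d) g] plus a scalar, so [t (t^2 - d) (t^2 - 3 d) = 0]
   unless [g] is a scalar. *)
Lemma order6_int2 (g : int * int -> int * int) : {morph g : x y / x + y} ->
  has_order g 6 -> forall x, g x - g (g x) = x.
Proof.
move=> gD [_ g6 gmin].
have nz k : (0 < k < 6)%N -> ~ forall x, iter k g x = x.
  by move=> /gmin[x gx] /(_ x).
have gE x := additive_int2E x gD; move: (g (1, 0)) (g (0, 1)) gE => [p q] [r s] /= gE.
(* Trace and determinant of the matrix with columns [(p, q)] and [(r, s)]. *)
pose t := p + s; pose d := p * s - q * r.
have g2 x : g (g x) = (t * (g x).1 - d * x.1, t * (g x).2 - d * x.2).
  by rewrite !gE /t /d; congr (_, _) => /=; ring.
(* The identity [g^6 = u g - w] is the square of [g^3 = (t^2 - d) g - t d], reduced by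
   Cayley-Hamilton. *)
pose u := t * (t ^+ 2 - d) * (t ^+ 2 - 3 * d).
pose w := d * (t ^+ 4 - 3 * d * t ^+ 2 + d ^+ 2).
have g3 x : g (g (g x)) =
    ((t ^+ 2 - d) * (g x).1 - t * d * x.1, (t ^+ 2 - d) * (g x).2 - t * d * x.2).
  by rewrite !g2 /=; congr (_, _); ring.
have g6E x : iter 6 g x = (u * (g x).1 - w * x.1, u * (g x).2 - w * x.2).
  by rewrite /= g3 (g3 x) /= !gE /u /w /t /d; congr (_, _) => /=; ring.
have e1 := g6 (1, 0); have e2 := g6 (0, 1).
rewrite !g6E !gE /= in e1 e2.
have [e11 e12] := e1; have [e21 e22] := e2.
(* If [u] were nonzero, [g] would be multiplication by some [p] with [p^6 = 1], so [g^2 = 1]. *)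
have u0 : u = 0.
  apply/eqP/negPn/negP => un0.
  have q0 : q = 0.
    move: e12; rewrite !(mulr0, mulr1, addr0, subr0) => /eqP.
    by rewrite mulf_eq0 (negbTE un0) => /eqP.
  have r0 : r = 0.
    move: e21; rewrite !(mulr0, mulr1, add0r, subr0) => /eqP.
    by rewrite mulf_eq0 (negbTE un0) => /eqP.
  have ps : p = s.
    apply: (mulfI un0); move: e11 e22; rewrite !(mulr0, mulr1, add0r, addr0).
    by move=> /(canRL (subrK _)) -> /(canRL (subrK _)) ->.
  have p6 : p ^+ 6 = 1.
    by rewrite -e11 /u /w /t /d q0 -ps; ring.
  have p2 : p ^+ 2 = 1.
    move: p6; rewrite (_ : 6 = 2 * 3)%N // exprM => /eqP.
    by rewrite pexprn_eq1 ?sqr_ge0 // => /eqP.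
  apply: (@nz 2) => // -[a b]; rewrite /= !gE /= q0 r0 -ps.
  by rewrite !(mulr0, mul0r, addr0, add0r) !mulrA -expr2 p2 !mul1r.
(* Now [-w = 1] and [d] divides [w], so [d] is a unit. *)
have dw : d * - (t ^+ 4 - 3 * d * t ^+ 2 + d ^+ 2) = 1.
  by rewrite -[RHS]e11 u0 /w; ring.

have d2 : d ^+ 2 = 1.
  suff: d \is a intUnitRing.unitz by case/orP => /eqP->.
  exact: intUnitRing.unitzPl (etrans (mulrC _ _) dw).
have [t0|tn0] := eqVneq t 0.
  have d1 : d = -1.
    move: dw; rewrite t0 !expr0n /= mulr0 subr0 add0r mulrN -exprS exprS d2.
    by rewrite mulr1 => /eqP; rewrite eqr_oppLR => /eqP.
  case: (@nz 2) => // x.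
  by rewrite /= g2 t0 d1 !mul0r !sub0r !mulN1r !opprK -surjective_pairing.
have : (t ^+ 2 - d) * (t ^+ 2 - 3 * d) = 0.
  by apply/eqP; move: u0 => /eqP; rewrite /u -mulrA mulf_eq0 (negbTE tn0).
move=> tt; have t_neq0 : 0 < t ^+ 2 by rewrite exprn_even_gt0.
(* For [d = -1] both factors are positive; for [d = 1] the alternative [t^2 = 3] has no integer
   solution. *)
have [d1 t2] : d = 1 /\ t ^+ 2 = 1.
  have /eqP := d2; rewrite sqrf_eq1 => /orP[]/eqP d1; last first.
    by move: tt; rewrite d1; nia.
  split=> //; move: tt; rewrite d1 => /eqP; rewrite mulf_eq0 !subr_eq0.
  by case/orP => /eqP // t3; have [|] := leP 2 `|t|; nia.
(* Trace -1 would give [g^2 + g + 1 = 0], hence [g^3 = 1]. *)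
have t1 : t = 1.
  have /eqP := t2; rewrite sqrf_eq1 => /orP[]/eqP // t1; case: (@nz 3) => // x.
  rewrite /= g3 t2 t1 d1 subrr !mul0r !sub0r mulr1 !mulN1r.
  by rewrite !opprK -surjective_pairing.
move=> x; have -> : g (g x) = g x - x by rewrite g2 t1 d1 !mul1r.
by rewrite subKr.

Qed.

(** * Free homotopies and the action of loops *)


Section Tethered.
Variables (R : realType) (Y : ptopologicalType).

Lemma continuous_paste_le (Z : topologicalType) (p q : Z -> R) (f g : Z -> Y) :
  continuous p -> continuous q -> continuous f -> continuous g ->
  (forall z, p z = q z -> f z = g z) ->
  continuous (fun z => if p z <= q z then f z else g z).
Proof.
move=> cp cq cf cg fg.
have cpq : continuous (fun z => p z - q z) by exact: (@continuous_sub R R).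
apply: (@continuous_paste _ _ [set z | p z - q z <= 0] [set z | 0 <= p z - q z]
  (fun z => p z <= q z) f g).
- rewrite -[X in closed X]/((fun z => p z - q z) @^-1` [set t | t <= 0]).
  by apply: closed_comp => [z _|]; [exact: cpq|exact: closed_le].
- rewrite -[X in closed X]/((fun z => p z - q z) @^-1` [set t | 0 <= t]).
  by apply: closed_comp => [z _|]; [exact: cpq|exact: closed_ge].
- by move=> z /=; lra.
- by move=> z /=; rewrite -ltNge; lra.
- by move=> z /= ? ?; apply: fg; lra.
- exact: continuous_subspaceT.
- exact: continuous_subspaceT.
Qed.

Definition pconst (X : ptopologicalType) : pmap X Y :=
  PMap (@continuous_const X Y point) erefl.

Section Dimension.
Variables (n : nat) (n_gt0 : (0 < n)%N).
Implicit Types (x : 'rV[R]_n) (a b : pmap (sphere R n) Y)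
  (g : pmap (sphere R 1) Y).

Lemma outerP x : outer x <-> 1 <= radius x.
Proof.
split=> [[i xi]|rx].
  apply: le_trans (radius_ge x i).
  by case: xi => ?; [rewrite ler0_norm|rewrite ger0_norm]; lra.
have [|i ri] := @radius_attained _ _ x; first by rewrite gt_eqF //; lra.
exists i; move: rx; rewrite ri.
by case: (ler0P (2 * x ord0 i - 1)) => ? ?; [left|right]; lra.
Qed.

(** Both sides are the basepoint outside the cube, so rolled maps can be computed by their formulas
    on all of [R^n]. *)
Lemma roll_outer F cF oF F0 x : unroll (@roll R n Y F cF oF F0) x = F x.
Proof.
have [xo|xo] := pselect (outer x); first by rewrite unroll_outer ?oF.
have xc : x \in @in_cube R n.
  apply/mem_set => i; apply/andP; split; rewrite leNgt; apply/negP => /ltW xi;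
    apply: xo; exists i; [by left|by right].
by rewrite -[x](insubdK (point : cube R n) xc) unrollE; exact: roll_fun_pi.
Qed.

Lemma loop_actE g a x : unroll (loop_act g a) x = act_fun g a x.
Proof. exact: roll_outer. Qed.

Lemma concatE i a b x : unroll (concat i a b) x = concat_fun i a b x.
Proof. exact: roll_outer. Qed.

Lemma loop_outer g (t : R) : t <= 0 \/ 1 <= t -> unroll g (const_mx t) = point.
Proof. by move=> ot; apply: unroll_outer; exists ord0; rewrite mxE. Qed.

Lemma unroll_pconst m (x : 'rV[R]_m) : unroll (pconst (sphere R m)) x = point.
Proof. by []. Qed.

Lemma const_mx_continuous m (Z : topologicalType) (f : Z -> R) :
  continuous f -> continuous (fun z => const_mx (f z) : 'rV[R]_m).
Proof.
move=> cf.
have -> : (fun z => const_mx (f z) : 'rV[R]_m) = (fun z => f z *: const_mx 1).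
  by apply/funext => z; apply/rowP => j; rewrite !mxE mulr1.
by apply: (@continuous_scale R 'rV[R]_m) => //; exact: continuous_const.
Qed.

(* A free homotopy from b to a along which the basepoint runs through g. *)
Definition tethered g b a : Prop := exists H : 'rV[R]_n * R -> Y,
  [/\ continuous H, forall x, H (x, 0) = unroll b x,
      forall x, H (x, 1) = unroll a x &
      forall x t, outer x -> 0 <= t <= 1 -> H (x, t) = unroll g (const_mx t)].

Lemma clamp01_bounds (t : R) : 0 <= clamp01 t <= 1.
Proof. by have := clamp01_itv t; rewrite in_itv. Qed.

Lemma clamp01E (t : R) : 0 <= t <= 1 -> clamp01 t = t.
Proof. by move=> t01; rewrite clamp01_id ?in_itv. Qed.

Lemma clamp010 : clamp01 0 = 0 :> R.
Proof. by rewrite clamp01E // lexx ler01. Qed.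

Lemma clamp011 : clamp01 1 = 1 :> R.
Proof. by rewrite clamp01E // lexx ler01. Qed.

Lemma tethered_clamp g b a : tethered g b a -> exists H : 'rV[R]_n * R -> Y,
  [/\ continuous H, forall x, H (x, 0) = unroll b x,
      forall x, H (x, 1) = unroll a x &
      forall x t, outer x -> H (x, t) = unroll g (const_mx (clamp01 t))].
Proof.
move=> [H [cH H0 H1 Ho]]; exists (fun z => H (z.1, clamp01 z.2)); split=> /=.
- apply: continuous_compose cH; apply: continuous_pairing.
    exact: continuous_fst.
  exact: continuous_compose (@continuous_snd _ _) (@clamp01_continuous R).
- by move=> x; rewrite clamp010.
- by move=> x; rewrite clamp011.
- by move=> x t xo; apply: Ho => //; exact: clamp01_bounds.
Qed.

Lemma homotopic_tethered b a :
  homotopic R b a <-> tethered (pconst _) b a.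
Proof.
split=> [/homotopicP[H [cH H0 H1 Hp]]|/tethered_clamp[H [cH H0 H1 Ho]]].
  (* [j] is the projection of [R^n] onto the sphere, with the outer region going to the
     basepoint. *)
  pose j := unroll (PMap (@continuous_id (sphere R n)) erefl).
  exists (fun z => H (j z.1, z.2)); split=> //= [|x t xo _].
  - apply: continuous_compose cH; apply: continuous_pairing.
      exact: continuous_compose (@continuous_fst _ _) (@unroll_continuous _ _ _ _).
    exact: continuous_snd.
  - by rewrite /j unroll_outer //; exact: Hp.
apply/homotopicP.
pose G (s : sphere R n) (t : R) := H (\val (repr s), t).
have GE (x : cube R n) t : G (sphere_pi x) t = H (\val x, t).
  have : sphere_pi x = sphere_pi (repr (sphere_pi x)) by rewrite /sphere_pi reprK.
  rewrite /G => /sphere_piP[<- //|[/boundaryE bx /boundaryE bx']].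
  by rewrite !Ho.
have Gpoint t : G point t = point.
  have -> : point = sphere_pi (point : cube R n) by [].
  by rewrite GE Ho //; exact: (outer0 R (Ordinal n_gt0)).
exists (uncurry G); split=> [|s|s|//] /=.
(* Continuity on the quotient times [R]: the curried map is continuous into the compact-open
   topology, and [R] is locally compact. *)
- apply: (@continuous_uncurry _ _ _ G) => [|||s].
  + exact: locally_compactR.
  + exact: norm_hausdorff.
  + apply/(@quotient_continuous _ {eq_quot @collapse R n} {compact-open, R -> Y} G).
    apply: (@continuous_curry_fun _ _ _ (fun z : cube R n * R => G (\pi z.1) z.2)).
    have -> : (fun z : cube R n * R => G (\pi z.1) z.2) = fun z => H (\val z.1, z.2).
      by apply/funext => z; rewrite GE.
    apply: continuous_compose cH; apply: continuous_pairing.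
      exact: continuous_compose (@continuous_fst _ _) (@initial_continuous _ _ _).
    exact: continuous_snd.
  + apply: continuous_compose cH; apply: continuous_pairing.
      exact: continuous_const.
    exact: continuous_id.
- by rewrite /G H0 unrollE /sphere_pi reprK.
- by rewrite /G H1 unrollE /sphere_pi reprK.
Qed.

(** On the common face both homotopies follow the same loop [g], so they can be pasted at every
    time. *)
Lemma tethered_concat i g b a b' a' :
  tethered g b a -> tethered g b' a' ->
  tethered g (concat i b b') (concat i a a').
Proof.
move=> /tethered_clamp[H [cH H0 H1 Ho]] /tethered_clamp[K [cK K0 K1 Ko]].
exists (fun z : 'rV[R]_n * R => if z.1 ord0 i <= 2^-1 then
    H (z.1 + z.1 ord0 i *: delta_mx ord0 i, z.2)
  else K (z.1 + (z.1 ord0 i - 1) *: delta_mx ord0 i, z.2)).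
have c1 := @continuous_fst 'rV[R]_n R; have c2 := @continuous_snd 'rV[R]_n R.
have ci : continuous (fun z : 'rV[R]_n * R => z.1 ord0 i).
  exact: continuous_compose c1 (@coord_continuous R 1 n ord0 i).
split=> [|x|x|x t [j xj] t01].
- apply: continuous_paste_le => [//||||z zi]; first exact: continuous_const.
  + apply: continuous_compose cH; apply: continuous_pairing => //.
    apply: (@continuous_add R 'rV[R]_n) => //.
    by apply: (@continuous_scale R 'rV[R]_n) => //; exact: continuous_const.
  + apply: continuous_compose cK; apply: continuous_pairing => //.
    apply: (@continuous_add R 'rV[R]_n) => //.
    apply: (@continuous_scale R 'rV[R]_n); last exact: continuous_const.
    by apply: (@continuous_sub R R) => //; exact: continuous_const.
  + rewrite Ho; first rewrite Ko //.
      by exists i; left; rewrite stretchE eqxx zi; lra.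
    by exists i; right; rewrite stretchE eqxx zi; lra.
- by rewrite concatE /concat_fun /= H0 K0.
- by rewrite concatE /concat_fun /= H1 K1.
- rewrite -[t in RHS]clamp01E //=.
  case: ifPn => xi; [apply: Ho|apply: Ko]; exists j; rewrite stretchE;
    case: eqP xj => [->|_]; rewrite ?addr0 //.
  + by case=> ?; [left|right]; lra.
  + by rewrite -ltNge in xi; case=> ?; [left|right]; lra.
Qed.

(** Since [2 *: x - const_mx 1] is twice the offset from the centre, the argument is [x] rescaled
    about the centre by [2 * k]. *)
Lemma radius_affine x (k : R) :
  radius (k *: (2 *: x - const_mx 1) + const_mx 2^-1) = `|2 * k| * radius x.
Proof.
rewrite /radius -normrZ; congr (`| _ |); apply/rowP => j; rewrite !mxE.
by rewrite mulrDr mulfV ?pnatr_eq0 // addrK mulrA.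
Qed.

Lemma radius_ge0 x : 0 <= radius x.
Proof. exact: normr_ge0. Qed.

(** The copy of [a] grows from the half-size cube to the full cube and pushes the shell carrying [g]
    outwards. *)
Lemma tethered_loop_act g a : tethered g (loop_act g a) a.
Proof.
pose k (z : 'rV[R]_n * R) := 1 - 2^-1 * clamp01 z.2.
pose M z := unroll a (k z *: (2 *: z.1 - const_mx 1) + const_mx 2^-1).
(* The minimum freezes the shell beyond the cube; at radius 1 the loop parameter [2 - 2 * k] equals
   the time. *)
exists (fun z : 'rV[R]_n * R => if k z * radius z.1 <= 2^-1 then M z
  else unroll g (const_mx (2 - 2 * (k z * Num.min 1 (radius z.1))))).
have c1 := @continuous_fst 'rV[R]_n R; have c2 := @continuous_snd 'rV[R]_n R.
have ck : continuous k.
  apply: (@continuous_sub R R); first exact: continuous_const.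
  apply: (@continuous_scale R R); first exact: continuous_const.
  exact: continuous_compose c2 (@clamp01_continuous R).
have cr : continuous (fun z : 'rV[R]_n * R => radius z.1).
  exact: continuous_compose c1 (@radius_continuous R n).
have kP z : 2^-1 <= k z <= 1 by rewrite /k; have := clamp01_bounds z.2; lra.
have radiusM z : radius (k z *: (2 *: z.1 - const_mx 1) + const_mx 2^-1) =
    2 * (k z * radius z.1).
  by rewrite radius_affine ger0_norm -?mulrA //; have := kP z; lra.
split=> [|x|x|x t /outerP xo t01].
- apply: continuous_paste_le => [||||z kz].
  + exact: (@continuous_scale R R).
  + exact: continuous_const.
  + apply: continuous_compose; last exact: unroll_continuous.
    apply: (@continuous_add R 'rV[R]_n); last exact: continuous_const.
    apply: (@continuous_scale R 'rV[R]_n) => //.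
    exact: continuous_compose c1 (@double_continuous R n _).
  + apply: continuous_compose; last exact: unroll_continuous.
    apply: const_mx_continuous.
    apply: (@continuous_sub R R); first exact: continuous_const.
    apply: (@continuous_scale R R); first exact: continuous_const.
    apply: (@continuous_scale R R) => //.
    have cone : continuous (fun _ : 'rV[R]_n * R => 1 : R^o).
      exact: continuous_const.
    have cr' : continuous (fun z : 'rV[R]_n * R => radius z.1 : R^o) by [].
    by move=> z; exact: (continuous_min (cone z) (cr' z)).
  + rewrite /M unroll_outer; last by apply/outerP; rewrite radiusM kz; lra.
    rewrite loop_outer //; right.
    have r1 : radius z.1 <= 1.
      have := kP z; have := radius_ge0 z.1.
      by rewrite leNgt => r0 /andP[k0 k1]; apply/negP => r1; nra.
    by rewrite min_r // kz; lra.
- have k1 : k (x, 0) = 1 by rewrite /k /= clamp010; lra.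
  rewrite loop_actE /act_fun /= k1 mul1r; case: ifP => // _; last first.
    rewrite mul1r; case: (leP 1 (radius x)) => r1 //.
    by rewrite !loop_outer //; left; lra.
  rewrite /M k1; congr unroll; apply/rowP => j; rewrite !mxE /=; lra.
- have k1 : k (x, 1) = 2^-1 by rewrite /k /= clamp011; lra.
  rewrite /= k1; case: leP => r1.
    rewrite /M k1; congr unroll; apply/rowP => j; rewrite !mxE /=; lra.
  rewrite min_l; last by lra.
  rewrite loop_outer; last by right; lra.
  by rewrite unroll_outer //; apply/outerP; lra.
- have kE : k (x, t) = 1 - 2^-1 * t by rewrite /k /= clamp01E.
  rewrite /= min_l //; case: ifP => kr; last first.
    by congr unroll; rewrite kE; congr const_mx; lra.
  rewrite /M unroll_outer; last first.
    by apply/outerP; rewrite radiusM /=; have := kP (x, t); nra.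
  rewrite loop_outer //; right.
  by rewrite kE in kr; nra.
Qed.

(** Squeeze the stage at time [t] into the concentric cube of radius [1 - t / 2] and fill the shell
    with [g] run back to the basepoint. So [g] and the end of a tether determine the class of its
    start. *)
Lemma homotopic_loop_act g b a : tethered g b a -> homotopic R b (loop_act g a).
Proof.
move=> /tethered_clamp[H [cH H0 H1 Ho]]; apply/homotopic_tethered.
pose k (z : 'rV[R]_n * R) := 1 - 2^-1 * clamp01 z.2.
pose M z := H ((2 * k z)^-1 *: (2 *: z.1 - const_mx 1) + const_mx 2^-1, z.2).
exists (fun z : 'rV[R]_n * R => if radius z.1 <= k z then M z
  else unroll g (const_mx (2 - 2 * radius z.1))).
have c1 := @continuous_fst 'rV[R]_n R; have c2 := @continuous_snd 'rV[R]_n R.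
have ck : continuous k.
  apply: (@continuous_sub R R); first exact: continuous_const.
  apply: (@continuous_scale R R); first exact: continuous_const.
  exact: continuous_compose c2 (@clamp01_continuous R).
have cr : continuous (fun z : 'rV[R]_n * R => radius z.1).
  exact: continuous_compose c1 (@radius_continuous R n).
have kP z : 2^-1 <= k z <= 1 by rewrite /k; have := clamp01_bounds z.2; lra.
have outerM z : k z <= radius z.1 ->
    outer ((2 * k z)^-1 *: (2 *: z.1 - const_mx 1) + const_mx 2^-1).
  move=> kr; apply/outerP; rewrite radius_affine.
  have k0 : 0 < k z by have := kP z; lra.
  by rewrite invfM mulVKf ?pnatr_eq0 // gtr0_norm ?invr_gt0 // ler_pdivlMl // mulr1.
split=> [|x|x|x t /outerP xo t01].
- apply: continuous_paste_le => [//|//|||z kz].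
  + apply: continuous_compose cH; apply: continuous_pairing => //.
    apply: (@continuous_add R 'rV[R]_n); last exact: continuous_const.
    apply: (@continuous_scale R 'rV[R]_n).
      move=> z; apply: cvgV; first by have := kP z; lra.
      by apply: cvgM; [exact: cvg_cst|exact: ck].
    exact: continuous_compose c1 (@double_continuous R n _).
  + apply: continuous_compose; last exact: unroll_continuous.
    apply: const_mx_continuous.
    apply: (@continuous_sub R R); first exact: continuous_const.
    by apply: (@continuous_scale R R) => //; exact: continuous_const.
  + rewrite /M Ho; last by apply: outerM; rewrite kz.
    by congr unroll; rewrite kz /k; congr const_mx; lra.
- have k1 : k (x, 0) = 1 by rewrite /k /= clamp010; lra.
  rewrite /= k1; case: leP => r1.
    by rewrite /M k1 H0; congr unroll; apply/rowP => j; rewrite !mxE /=; lra.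
  rewrite loop_outer; last by left; lra.
  by rewrite unroll_outer //; apply/outerP; lra.
- have k1 : k (x, 1) = 2^-1 by rewrite /k /= clamp011; lra.
  rewrite loop_actE /act_fun /= k1; case: ifP => // _.
  by rewrite /M k1 H1; congr unroll; apply/rowP => j; rewrite !mxE /=; lra.
- rewrite unroll_pconst /=; case: ifP => kr; last by rewrite loop_outer //; left; lra.
  have t0 : t = 0 by move: kr; rewrite /k /= clamp01E //; lra.
  rewrite /M Ho /= ?t0 ?clamp010 ?loop_outer //; first by left.
  by rewrite -t0; apply: outerM; rewrite /=; have := kP (x, t); lra.
Qed.

Lemma homotopic_loop_act2 g a a' :
  homotopic R a a' -> homotopic R (loop_act g a) (loop_act g a').
Proof.
move=> /homotopic_tethered/tethered_clamp[H [cH H0 H1 Ho]].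
apply/homotopic_tethered.
exists (fun z : 'rV[R]_n * R =>
  if radius z.1 <= 2^-1 then H (2 *: z.1 - const_mx 2^-1, z.2)
  else unroll g (const_mx (2 - 2 * radius z.1))).
have c1 := @continuous_fst 'rV[R]_n R; have c2 := @continuous_snd 'rV[R]_n R.
have cr : continuous (fun z : 'rV[R]_n * R => radius z.1).
  exact: continuous_compose c1 (@radius_continuous R n).
split=> [|x|x|x t /outerP xo t01].
- apply: continuous_paste_le => [//||||z rz]; first exact: continuous_const.
  + apply: continuous_compose cH; apply: continuous_pairing => //.
    exact: continuous_compose c1 (@double_continuous R n _).
  + apply: continuous_compose; last exact: unroll_continuous.
    apply: const_mx_continuous.
    apply: (@continuous_sub R R); first exact: continuous_const.
    by apply: (@continuous_scale R R) => //; exact: continuous_const.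
  + rewrite loop_outer; last by right; rewrite rz; lra.
    have -> : 2 *: z.1 - const_mx 2^-1 =
        1 *: (2 *: z.1 - const_mx 1) + const_mx 2^-1.
      by apply/rowP => j; rewrite !mxE; lra.
    by rewrite Ho //; apply/outerP; rewrite radius_affine rz ger0_norm; lra.
- by rewrite loop_actE /act_fun /= H0.
- by rewrite loop_actE /act_fun /= H1.
- rewrite unroll_pconst ifF /=; last by apply/negbTE; rewrite -ltNge; lra.
  by rewrite loop_outer //; left; lra.
Qed.

End Dimension.
End Tethered.

(** * Families of maps with independent switches *)

Lemma alternating_Hom (U V : zmodType) m (F : seq bool -> Hom U V) c :
  alternating m F c = alternating m (fun e => F e c).
Proof. by elim: m F => //= m IH F; rewrite -!IH. Qed.

(** * Sum and loop action on homotopy classes *)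

Section Classes.
Variables (R : realType) (Y : ptopologicalType) (n : nat) (n_gt0 : (0 < n)%N).
Implicit Types (a b : pmap (sphere R n) Y) (g : htpy_group R Y 1)
  (x y : htpy_group R Y n).

Lemma htpy_class_repr x : htpy_class R (repr x) = x.
Proof. exact: reprK. Qed.

Lemma homotopic_repr a : homotopic R (repr (htpy_class R a)) a.
Proof. by apply/htpy_classP; rewrite htpy_class_repr. Qed.

(** Pointed homotopies are tethers along the constant loop and can be concatenated. *)
Lemma htpy_add_class a b : htpy_add n_gt0 (htpy_class R a) (htpy_class R b) =
  htpy_class R (concat (Ordinal n_gt0) a b).
Proof.
apply/htpy_classP/(homotopic_tethered n_gt0).
by apply: tethered_concat; apply/(homotopic_tethered n_gt0)/homotopic_repr.
Qed.

Lemma htpy_act_class g a :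
  htpy_act g (htpy_class R a) = htpy_class R (loop_act (repr g) a).
Proof. exact/htpy_classP/(homotopic_loop_act2 n_gt0)/homotopic_repr. Qed.

(** Concatenating the tethers of both summands along [g] gives a tether ending at the sum of [x] and
    [y], and this determines the class of its start. *)
Lemma htpy_act_add g x y :
  htpy_act g (htpy_add n_gt0 x y) = htpy_add n_gt0 (htpy_act g x) (htpy_act g y).
Proof.
rewrite -[x]htpy_class_repr -[y]htpy_class_repr.
rewrite htpy_add_class !htpy_act_class htpy_add_class.
apply/esym/htpy_classP/(homotopic_loop_act n_gt0)/tethered_concat;
  exact: tethered_loop_act.
Qed.

Lemma loop_act_pconst a :
  htpy_class R (loop_act (pconst Y _) a) = htpy_class R a.
Proof.
apply/esym/htpy_classP/(homotopic_loop_act n_gt0)/(homotopic_tethered n_gt0).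
exact: homotopic_refl.
Qed.

(** Idempotency identifies this class with 0 once addition is carried to a group. *)
Lemma htpy_add_pconst :
  htpy_add n_gt0 (htpy_class R (pconst Y _)) (htpy_class R (pconst Y _)) =
  htpy_class R (pconst Y _).
Proof.
rewrite htpy_add_class; apply/htpy_classP/(homotopic_tethered n_gt0).
exists (fun=> point); split=> // [|x].
- exact: continuous_const.
- by rewrite concatE /concat_fun !unroll_pconst if_same.
Qed.

End Classes.

(** * Iterated concatenations and nested shells of loops *)

Section Families.
Variables (R : realType) (Y : ptopologicalType) (n : nat) (i : 'I_n).
Implicit Types (a b : pmap (sphere R n) Y) (g : pmap (sphere R 1) Y)
  (F : seq bool -> pmap (sphere R n) Y).

Definition switch m (b : bool) (a : pmap (sphere R m) Y) :=
  if b then a else pconst Y _.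

(** Switches act in disjoint regions, so a tuple of points detects at most as many switches as it
    has entries. *)
Definition pointwise_single F := forall x : 'rV[R]_n, exists k,
  forall e e', nth false e k = nth false e' k ->
    unroll (F e) x = unroll (F e') x.

Fixpoint concat_family (s : seq (pmap (sphere R n) Y)) b (e : seq bool) :=
  if s is a :: s' then
    concat i (switch (nth false e 0) a) (concat_family s' b (behead e))
  else b.

(** The first switch governs the outermost shell; the other loops lie inside the half-size cube. *)
Fixpoint act_family m g b (e : seq bool) :=
  if m is m'.+1 then
    loop_act (switch (nth false e 0) g) (act_family m' g b (behead e))
  else b.

Lemma concat_switch_single a F : pointwise_single F ->
  pointwise_single (fun e => concat i (switch (nth false e 0) a) (F (behead e))).
Proof.
move=> FP x; have [xi|xi] := leP (x ord0 i) 2^-1.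
  by exists 0 => e e' ee'; rewrite !concatE /concat_fun xi ee'.
have [k kP] := FP (x + (x ord0 i - 1) *: delta_mx ord0 i).
exists k.+1 => e e' ee'; rewrite !concatE /concat_fun leNgt xi.
by apply: kP; rewrite !nth_behead.
Qed.

Lemma loop_act_switch_single g F : pointwise_single F ->
  pointwise_single (fun e => loop_act (switch (nth false e 0) g) (F (behead e))).
Proof.
move=> FP x; have [rx|rx] := leP (radius x) 2^-1; last first.
  by exists 0 => e e' ee'; rewrite !loop_actE /act_fun leNgt rx ee'.
have [k kP] := FP (2 *: x - const_mx 2^-1).
exists k.+1 => e e' ee'; rewrite !loop_actE /act_fun rx.
by apply: kP; rewrite !nth_behead.
Qed.

Lemma concat_family_single s b : pointwise_single (concat_family s b).
Proof.
by elim: s => [|a s IH]; [exists 0|exact: concat_switch_single].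
Qed.

Lemma act_family_single m g b : pointwise_single (act_family m g b).
Proof.
by elim: m => [|m IH]; [exists 0|exact: loop_act_switch_single].
Qed.

(** The unswitched summand [a] serves to realise translation by its class. *)
Lemma concat_single a F :
  pointwise_single F -> pointwise_single (fun e => concat i a (F e)).
Proof.
move=> FP x; have [xi|xi] := leP (x ord0 i) 2^-1.
  by exists 0 => e e' _; rewrite !concatE /concat_fun xi.
have [k kP] := FP (x + (x ord0 i - 1) *: delta_mx ord0 i).
by exists k => e e' ee'; rewrite !concatE /concat_fun leNgt xi; exact: kP.
Qed.

(* The [r] points of a tuple feel at most [r < m] of the [m] switches. *)
Lemma alternating_chain0 r m F : (r < m)%N -> pointwise_single F ->
  alternating m (fun e => chain0_map (pow_map (r := r) (F e))) = 0.
Proof.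
move=> rm FP; set h := alternating _ _; apply: HomP => c.
have h_gen (k : int) (x : r.-tuple (sphere R n)) : h << k *g x >> = 0.
  rewrite /h alternating_Hom.
  have d_ex (j : 'I_r) : exists dj : nat, forall e e',
      nth false e dj = nth false e' dj -> F e (tnth x j) = F e' (tnth x j).
    have [dj djP] := FP (\val (repr (tnth x j))).
    by exists dj => e e' /djP; rewrite !unrollE /sphere_pi reprK.
  have [d dP] := choice d_ex.
  (* Pigeonhole: the [r] indices [d k] cannot exhaust the [m] switches, and no entry of the tuple
     feels the missed switch [j]. *)
  have [j jm jd] : exists2 j, (j < m)%N & j \notin [seq d k | k <- enum 'I_r].
    apply: contrapT => nj; suff : (m <= r)%N by rewrite leqNgt rm.
    rewrite -(size_iota 0 m) -[leqRHS]card_ord cardE -(size_map d).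
    apply: uniq_leq_size (iota_uniq _ _) _ => j; rewrite mem_iota /= => jm.
    by apply/negPn/negP => jd; apply: nj; exists j.
  apply: (alternating_independent jm) => e e' ee'.
  rewrite /chain0_map /= /chain0_fun !liftU; congr (_ *: << _ >>).
  apply: eq_from_tnth => p; rewrite !tnth_map; apply: dP; apply: ee'.
  by apply: contraNneq jd => <-; apply: map_f; rewrite mem_enum.
elim/freeg_ind_dom0: c => [|k x c _ _ IH]; first by rewrite raddf0.
by rewrite raddfD IH h_gen addr0.
Qed.

End Families.

(** * Degree bounds carried over to an abelian group *)

Section Transport.
Variables (R : realType) (Y : ptopologicalType) (n : nat) (n_gt0 : (0 < n)%N).
Variables (L V : zmodType) (phi : htpy_group R Y n -> L)
  (psi : L -> htpy_group R Y n) (g : htpy_group R Y 1).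
Hypotheses (phiK : cancel phi psi) (psiK : cancel psi phi).
Hypothesis phiD : forall x y, phi (htpy_add n_gt0 x y) = phi x + phi y.
Implicit Types (a b : pmap (sphere R n) Y) (f : htpy_group R Y n -> V)
  (h : L -> V).

Local Notation i := (Ordinal n_gt0).
Local Notation class a := (phi (htpy_class R a)).
Local Notation act := (phi \o htpy_act g \o psi).

Lemma act_additive x y : act (x + y) = act x + act y.
Proof.
rewrite /= -phiD -htpy_act_add -[in LHS](psiK x) -[in LHS](psiK y).
by rewrite -phiD phiK.
Qed.

Lemma class_concat a b : class (concat i a b) = class a + class b.
Proof. by rewrite -phiD htpy_add_class. Qed.

Lemma class_pconst : class (pconst Y _) = 0.
Proof.
by apply: (addrI (class (pconst Y _))); rewrite -phiD htpy_add_pconst addr0.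
Qed.

Lemma class_repr x : class (repr (psi x)) = x.
Proof. by rewrite htpy_class_repr psiK. Qed.

(** The homomorphism [l] commutes with the alternating sum, which vanishes already for the chain
    maps. *)
Lemma alternating_class f r m F : deg_le f r -> (r < m)%N ->
  pointwise_single F -> alternating m (fun e => (f \o psi) (class (F e))) = 0.
Proof.
move=> [l lE] rm FP.
rewrite (eq_alternating m (F' := fun e =>
  l (chain0_map (pow_map (r := r) (F e))))); last by move=> e /=; rewrite phiK lE.
by rewrite -alternating_raddf alternating_chain0 ?raddf0.
Qed.

(** Switching the first summand on and off is [difference] by its class, and every element of [L] is
    the class of a map; [b] supplies the evaluation point. *)
Lemma degree_lt_class m h :
  (forall s b, size s = m ->
    alternating m (fun e => h (class (concat_family i s b e))) = 0) ->
  degree_lt m h.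
Proof.
elim: m h => [|m IH] h hs /=.
  by move=> y; have := hs [::] (repr (psi y)) erefl; rewrite /= class_repr.
move=> x; apply: IH => s b sm.
have := hs (repr (psi x) :: s) b; rewrite /= sm => /(_ erefl) <-.
rewrite alternatingB; congr (_ - _); apply: eq_alternating => e.
  by rewrite class_concat class_repr.
by rewrite class_concat class_pconst add0r.
Qed.

(** The outermost loop, switched on, applies [g] to the inner class; switched off, it leaves that
    class unchanged. So [h] becomes [twist act h] on the inner family. *)
Lemma alternating_act m h b :
  alternating m (fun e => h (class (act_family m (repr g) b e))) =
  iter m (twist act) h (class b).
Proof.
elim: m h => //= m IH h; rewrite -iterS iterSr.
rewrite [X in iter m _ X]/twist iter_twistB -IH -IH.
congr (_ - _); apply: eq_alternating => e /=.
  by rewrite phiK htpy_act_class.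
by rewrite loop_act_pconst.
Qed.

End Transport.

Theorem mainTheorem4 (R : realType) (n : nat) (n_gt1 : (1 < n)%N)
    (Y : ptopologicalType)
    (pi_nY : exists phi : htpy_group R Y n -> (int * int)%type,
      bijective phi /\
      forall x y, phi (htpy_add (ltnW n_gt1) x y) = (phi x + phi y)%R)
    (order6 : exists g : htpy_group R Y 1, has_order (htpy_act (n := n) g) 6)
    (V : zmodType) (f : htpy_group R Y n -> V) :
  finite_degree f -> forall x y, f x = f y.
Proof.
move=> [r fr]; have [phi [[psi phiK psiK] phiD]] := pi_nY.
have [g [_ g6 gmin]] := order6; pose n_gt0 := ltnW n_gt1.
pose G := phi \o htpy_act g \o psi.
have GD := act_additive g phiK psiK phiD : {morph G : x y / x + y}.
have iterG k x : iter k G x = phi (iter k (htpy_act g) (psi x)).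
  by elim: k => [|k IH] /=; rewrite ?psiK // IH /G /= phiK.
have G6 : has_order G 6.
  split=> // [x|j /gmin[x gx]]; first by rewrite iterG g6 psiK.
  by exists (phi x); rewrite iterG phiK => /(can_inj phiK).
have G_sub : forall x, G x - G (G x) = x by exact: order6_int2.
have hc : forall x y, (f \o psi) x = (f \o psi) y.
  (* Both bounds are [r + 1]: more switches than the [r] entries of a tuple. *)
  apply: (twist_nilpotent_constant GD G_sub (ltn0Sn r) _ (k := r.+1)).
    move=> z y; rewrite -(class_repr psiK y) -alternating_act //.
    (* Prepending a representative of [z] realises the shift by [z]. *)
    have single := concat_single (Ordinal n_gt0) (repr (psi z))
      (act_family_single r.+1 (repr g) (repr (psi y))).
    rewrite -[RHS](alternating_class phiK fr (ltnSn r) single).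
    by apply: eq_alternating => e; rewrite (class_concat phiD) (class_repr psiK).
  apply: (degree_lt_class psiK phiD) => s b _.
  exact: (alternating_class phiK fr (ltnSn r) (concat_family_single _ s b)).
by move=> x y; have := hc (phi x) (phi y); rewrite /= !phiK.
Qed.
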